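(* Let $k\ge 2$ and let $G$ be a connected $k$-uniform hypergraph with maximum degree $\Delta$, minimum degree $\delta$, spectral radius $\rho(G)$ and principal ratio $\gamma$. Then $$\frac{\Delta}{\gamma^{k-1}}\le\rho(G)\le\gamma^{k-1}\delta.$$
   Context: A $k$-uniform hypergraph $G$ has a finite vertex set $V(G)=\{1,\dots,n\}$ and a set $E(G)$ of edges, each of which is a set of exactly $k$ distinct vertices. The degree $d_i$ of a vertex $i$ is the number of edges containing $i$; $\Delta=\max_i d_i$, $\delta=\min_i d_i$. A path from $u$ to $v$ is an alternating sequence $v_0e_1v_1e_2\cdots v_{l-1}e_lv_l$ with $v_0=u$, $v_l=v$, where the vertices $v_0,\dots,v_l$ are distinct, the edges $e_1,\dots,e_l$ are distinct, and $v_{i-1},v_i\in e_i$ for $i=1,\dots,l$; $G$ is connected if there is a path between any two vertices. The adjacency tensor of $G$ is $\mathcal{A}_G=(a_{i_1\cdots i_k})$, of order $k$ and dimension $n$, with $a_{i_1\cdots i_k}=\frac{1}{(k-1)!}$ if $\{i_1,\dots,i_k\}\in E(G)$ and $a_{i_1\cdots i_k}=0$ otherwise. For $x\in\mathbb{C}^n$, $\mathcal{A}_Gx^{k-1}\in\mathbb{C}^n$ has $i$-th component $\sum_{i_2,\dots,i_k=1}^n a_{ii_2\cdots i_k}x_{i_2}\cdots x_{i_k}$. A number $\lambda\in\mathbb{C}$ is an eigenvalue of $\mathcal{A}_G$ with eigenvector $x\in\mathbb{C}^n\setminus\{0\}$ if $\mathcal{A}_Gx^{k-1}=\lambda x^{[k-1]}$,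 where $x^{[k-1]}=(x_1^{k-1},\dots,x_n^{k-1})^{\mathrm T}$. The spectral radius $\rho(G)$ is the maximum modulus of the eigenvalues of $\mathcal{A}_G$. For $G$ connected, by the Perron–Frobenius theorem for nonnegative weakly irreducible tensors, $\rho(G)$ is an eigenvalue and there is a unique eigenvector $x=(x_1,\dots,x_n)^{\mathrm T}$ for $\rho(G)$ with all entries positive and $\sum_{i=1}^n x_i^k=1$; it is called the principal eigenvector of $G$. Write $x_{\max}=\max_i x_i$, $x_{\min}=\min_i x_i$. The principal ratio of $G$ is $\gamma=x_{\max}/x_{\min}$. *)

(* Defs.v *)
From HB Require Import structures.
From mathcomp Require Import all_boot all_order all_algebra complex.
From mathcomp Require Import boolp classical_sets reals.

Set Implicit Arguments.
Unset Strict Implicit.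
Unset Printing Implicit Defensive.

Import Order.TTheory GRing.Theory Num.Theory.

Local Open Scope ring_scope.

Record hypergraph (k n : nat) := Hypergraph {
  edges : {set {set 'I_n}};
  uniform_edges : forall e, e \in edges -> #|e| = k
}.

Definition degree k n (G : hypergraph k n) (i : 'I_n) : nat :=
  #|[set e in edges G | i \in e]|.

(* Vertex sets are ['I_n.+1], so that maxima and minima over the vertices
   exist; the value at [ord0] serves as the neutral element below. *)
Definition max_degree k n (G : hypergraph k n.+1) : nat :=
  \big[maxn/degree G ord0]_i degree G i.

Definition min_degree k n (G : hypergraph k n.+1) : nat :=
  \big[minn/degree G ord0]_i degree G i.

(* The alternating sequence v_0 e_1 v_1 ... e_l v_l is encoded by u = v_0 and
   p = [:: (e_1, v_1); ...; (e_l, v_l)]. *)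
Fixpoint incident n (u : 'I_n) (p : seq ({set 'I_n} * 'I_n)) : bool :=
  if p is (e, v) :: p' then [&& u \in e, v \in e & incident v p'] else true.

Definition hyperpath k n (G : hypergraph k n) (u v : 'I_n)
    (p : seq ({set 'I_n} * 'I_n)) : bool :=
  [&& incident u p, last u (unzip2 p) == v,
      all (mem (edges G)) (unzip1 p), uniq (u :: unzip2 p) & uniq (unzip1 p)].

Definition connected_hypergraph k n (G : hypergraph k n) : Prop :=
  forall u v, exists p, hyperpath G u v p.

(* A tensor of order k >= 1 and dimension n: the first index is separated from
   the k - 1 remaining ones. *)
Definition tensor (F : Type) (k n : nat) : Type :=
  'I_n -> k.-1.-tuple 'I_n -> F.

(* The vector A x^{k-1}. *)
Definition tensor_apply (F : comNzRingType) k n (A : tensor F k n)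
    (x : 'cV[F]_n) : 'cV[F]_n :=
  \col_i \sum_(t : k.-1.-tuple 'I_n) A i t * \prod_(j <- t) x j 0.

Definition adjacency_tensor (F : fieldType) k n (G : hypergraph k n) :
    tensor F k n :=
  fun i t => if [set:: i :: t] \in edges G then (k.-1)`!%:R^-1 else 0.

Arguments adjacency_tensor F {k n} G i t.

Definition eigenpair (F : fieldType) k n (A : tensor F k n) (l : F)
    (x : 'cV[F]_n) : Prop :=
  x != 0 /\ tensor_apply A x = l *: map_mx (fun c => c ^+ k.-1) x.

Definition tensor_eigenvalue (F : fieldType) k n (A : tensor F k n) (l : F) : Prop :=
  exists x, eigenpair A l x.

Definition eigenvalue_moduli (R : realType) k n (G : hypergraph k n) : set R :=
  [set Normc.normc l |
    l in [set l : R[i] | tensor_eigenvalue (adjacency_tensor _ G) l]]%classic.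

Arguments eigenvalue_moduli R {k n} G.

(* The supremum is a maximum whenever a principal eigenvector exists: see
   [spectral_radius_max]. *)
Definition spectral_radius (R : realType) k n (G : hypergraph k n) : R :=
  sup (eigenvalue_moduli R G).

Arguments spectral_radius R {k n} G.

Definition principal_eigenvector (R : realType) k n (G : hypergraph k n)
    (x : 'cV[R]_n) : Prop :=
  [/\ eigenpair (adjacency_tensor _ G) (real_complex R (spectral_radius R G))
        (map_mx (real_complex R) x),
      forall i, 0 < x i 0
    & \sum_i x i 0 ^+ k = 1].

Definition max_entry (R : realType) n (x : 'cV[R]_n.+1) : R :=
  \big[Num.max/x ord0 0]_i x i 0.

Definition min_entry (R : realType) n (x : 'cV[R]_n.+1) : R :=
  \big[Num.min/x ord0 0]_i x i 0.

Definition principal_ratio (R : realType) n (x : 'cV[R]_n.+1) : R :=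
  max_entry x / min_entry x.

Lemma eigenvalue_moduli_has_ubound (R : realType) k n (G : hypergraph k n) :
  has_ubound (eigenvalue_moduli R G).
Proof.
pose A := adjacency_tensor R[i] G.
exists (complex.Re (\sum_i \sum_t `|A i t|)) => _ [l [x [x0 Ax]] <-].
have -> : Normc.normc l = complex.Re `|l| by case: l {Ax}.
suff: `|l| <= \sum_i \sum_t `|A i t| by rewrite lecE => /andP[].
have [i0 xi0] : exists i, x i 0 != 0.
  apply/existsP; apply: contraNT x0; rewrite negb_exists => /forallP x0.
  by apply/eqP/colP => i; rewrite mxE; apply/eqP; rewrite -[_ == _]negbK.
pose f i := complex.Re `|x i 0|.
have fE i : `|x i 0| = real_complex R (f i) by rewrite /f !normc_def.
pose m := [arg max_(i > i0) f i]%O.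
have mM i : `|x i 0| <= `|x m 0|.
  by rewrite !fE lecR /m; case: arg_maxP => // j _; apply.
have xm0 : 0 < `|x m 0| by apply: lt_le_trans (mM i0); rewrite normr_gt0.
have : l * x m 0 ^+ k.-1 = \sum_t A m t * \prod_(j <- t) x j 0.
  by have /colP/(_ m) := Ax; rewrite !mxE => ->.
move=> /(congr1 Num.norm); rewrite normrM normrX => lE.
rewrite -(ler_pM2r (exprn_gt0 k.-1 xm0)) lE (le_trans (ler_norm_sum _ _ _))//.
rewrite (bigD1 m)//= mulrDl ler_wpDr//.
  by rewrite mulr_ge0 ?exprn_ge0 ?sumr_ge0// => i _; rewrite sumr_ge0.
rewrite mulr_suml ler_sum// => t _; rewrite normrM ler_wpM2l// normr_prod.
rewrite -{2}(size_tuple t); elim: (tval t) => [|j s IH].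
  by rewrite big_nil expr0.
by rewrite big_cons /= exprS ler_pM ?prodr_ge0.
Qed.

Lemma spectral_radius_max (R : realType) k n (G : hypergraph k n)
    (x : 'cV[R]_n) : principal_eigenvector G x ->
  eigenvalue_moduli R G (spectral_radius R G) /\
  ubound (eigenvalue_moduli R G) (spectral_radius R G).
Proof.
move=> [ex _ _]; have bE := @eigenvalue_moduli_has_ubound R k n G.
set r := spectral_radius R G in ex *.
have rE : eigenvalue_moduli R G `|r|.
  exists (real_complex R r); first by exists (map_mx (real_complex R) x).
  by rewrite /Normc.normc /= expr0n addr0 sqrtr_sqr.
have ubr : ubound (eigenvalue_moduli R G) r by exact: ub_le_sup.
have rE' : `|r| = r by apply/eqP; rewrite eq_le ler_norm (ubr _ rE).
by split=> //; rewrite -rE'.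
Qed.

(* Main.v *)
Require Import Defs.
From mathcomp Require Import all_boot all_order all_algebra reals.
From mathcomp Require Import complex.

(** The [i]-th slice of the adjacency tensor has total mass [degree G i]: an
    edge [e] through [i] is hit by exactly the [(k-1)!] orderings of [e :\ i],
    which the normalisation [1/(k-1)!] compensates
    ([sum_adjacency_tensor]). Each monomial of [(A x^{k-1})_i] is a product of
    [k-1] entries of [x], hence lies between [x_min^{k-1}] and [x_max^{k-1}], so
    the eigenvalue equation at a vertex [i] gives
      [d_i x_min^{k-1} <= rho x_i^{k-1} <= d_i x_max^{k-1}]
    ([tensor_apply_adjacency_bounds]). Dividing by [x_i^{k-1}], which itself
    lies between [x_min^{k-1}] and [x_max^{k-1}], yields
      [d_i / gamma^{k-1} <= rho <= gamma^{k-1} d_i]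
    for every [i] ([degree_ratio_bounds]). The left inequality is then read at a
    vertex of maximum degree and the right one at a vertex of minimum degree. *)

Set Implicit Arguments.
Unset Strict Implicit.
Unset Printing Implicit Defensive.

Import Order.TTheory GRing.Theory Num.Theory.

Local Open Scope ring_scope.

(** When [#|e| = m.+1], a sequence [i :: t] of length [m.+1] spans [e] only if
    it has no repetition, so the tuples counted are the orderings of
    [e :\ i]. *)
Lemma card_tuples_completing (T : finType) (m : nat) (i : T) (e : {set T}) :
  i \in e -> #|e| = m.+1 ->
  #|[set t : m.-tuple T | [set:: i :: t] == e]| = m`!.
Proof.
move=> ie ce; have cei : #|e :\ i| = m.
  by have := cardsD1 i e; rewrite ie ce => -[].
have -> : m`! = #|e :\ i| ^_ m by rewrite cei ffactnn.
rewrite -card_uniq_tuples; apply: eq_card => t; rewrite !inE.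
apply/eqP/andP => [te | [/allP te ut]].
  have : uniq (i :: t).
    by apply/card_uniqP; rewrite /= size_tuple -ce -te cardsE.
  move=> /= /andP[it ut]; split=> //; apply/allP => j jt.
  rewrite -[_ j]/(j \in e :\ i) in_setD1 -te !inE jt orbT andbT.
  by apply: contraNneq it => <-.
have {}te j : j \in t -> j \in e :\ i by move=> /te.
have it : i \notin t by apply/negP => /te; rewrite !inE eqxx.
apply/eqP; rewrite eqEcard ce cardsE; apply/andP; split.
  apply/subsetP => j; rewrite !inE => /predU1P[-> // | /te].
  by rewrite !inE => /andP[].
have /card_uniqP -> : uniq (i :: t) by rewrite /= it.
by rewrite /= size_tuple.
Qed.

(** Grouping the tuples by the edge that they complete turns the row sum into
    one contribution [(k-1)! / (k-1)! = 1] for each edge through [i]. *)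
Lemma sum_adjacency_tensor (F : numFieldType) k n (G : hypergraph k n)
    (i : 'I_n) : \sum_t adjacency_tensor F G i t = (degree G i)%:R.
Proof.
rewrite /adjacency_tensor -big_mkcond /=.
rewrite (partition_big (fun t : k.-1.-tuple 'I_n => [set:: i :: t])
           (mem [set e in edges G | i \in e])) /=; last first.
  by move=> t tG; rewrite !inE tG eqxx.
rewrite /degree -sum1_card natr_sum; apply: eq_bigr => e; rewrite inE.
move=> /andP[eG ie]; have ek := uniform_edges eG.
have ce : #|e| = k.-1.+1.
  by rewrite prednK// -ek; apply/card_gt0P; exists i.
rewrite (eq_bigl (mem [set t : k.-1.-tuple 'I_n | [set:: i :: t] == e])).
  rewrite sumr_const card_tuples_completing// -[LHS]mulr_natr mulVf//.
  by rewrite pnatr_eq0 -lt0n fact_gt0.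
by move=> t; rewrite !inE; case: eqP => [->|_]; rewrite ?eG ?andbF.
Qed.

Lemma tensor_apply_adjacency_bounds (F : numFieldType) k n
    (G : hypergraph k n) (x : 'cV[F]_n) (a b : F) (i : 'I_n) :
  0 <= a -> (forall j, a <= x j 0 <= b) ->
  (degree G i)%:R * a ^+ k.-1 <= tensor_apply (adjacency_tensor F G) x i 0
    <= (degree G i)%:R * b ^+ k.-1.
Proof.
move=> a0 axb; rewrite -sum_adjacency_tensor !mulr_suml mxE.
have A0 t : 0 <= adjacency_tensor F G i t.
  by rewrite /adjacency_tensor; case: ifP => // _; rewrite invr_ge0 ler0n.
have prod_const (c : F) : c ^+ k.-1 = \prod_(j < k.-1) c.
  by rewrite prodr_const card_ord.
apply/andP; split; apply: ler_sum => t _; apply: ler_wpM2l => //;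
  rewrite big_tuple prod_const; apply: ler_prod => j _.
  by rewrite a0; have /andP[] := axb (tnth t j).
by have /andP[ax ->] := axb (tnth t j); rewrite (le_trans a0 ax).
Qed.

Lemma map_tensor_apply_adjacency (F K : fieldType) (f : {rmorphism F -> K})
    k n (G : hypergraph k n) (x : 'cV[F]_n) :
  tensor_apply (adjacency_tensor K G) (map_mx f x) =
  map_mx f (tensor_apply (adjacency_tensor F G) x).
Proof.
apply/colP => i; rewrite !mxE rmorph_sum; apply: eq_bigr => t _.
rewrite rmorphM rmorph_prod /adjacency_tensor; congr (_ * _).
  by case: ifP => _; rewrite ?rmorph0// fmorphV rmorph_nat.
by apply: eq_bigr => j _; rewrite mxE.
Qed.

(** The eigenvalue equation lives over [R[i]], but both the eigenvalue and the
    eigenvector are real, so it descends to [R] along the injection of [R]. *)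
Lemma principal_eigenvectorE (R : realType) k n (G : hypergraph k n)
    (x : 'cV[R]_n) (i : 'I_n) : principal_eigenvector G x ->
  tensor_apply (adjacency_tensor R G) x i 0 =
  spectral_radius R G * x i 0 ^+ k.-1.
Proof.
move=> [[_ /colP/(_ i)]]; rewrite map_tensor_apply_adjacency !mxE => + _ _.
by rewrite -rmorphXn -rmorphM => /fmorph_inj.
Qed.

Lemma degree_ratio_bounds (R : realType) k n (G : hypergraph k n.+1)
    (x : 'cV[R]_n.+1) (i : 'I_n.+1) : principal_eigenvector G x ->
  (degree G i)%:R / principal_ratio x ^+ k.-1 <= spectral_radius R G <=
  principal_ratio x ^+ k.-1 * (degree G i)%:R.
Proof.
move=> hx; have [_ x0 _] := hx.
have min0 : 0 < min_entry x.
  by rewrite /min_entry; elim/big_ind: _ => // a b a0 b0; rewrite lt_min a0.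
have minmax j : min_entry x <= x j 0 <= max_entry x.
  apply/andP; split; first exact: (bigmin_le _ j (fun l => x l 0)).
  exact: (le_bigmax _ (fun l => x l 0)).
have max0 : 0 < max_entry x.
  by have /andP[mx xM] := minmax i; apply: lt_le_trans min0 (le_trans mx xM).
have := tensor_apply_adjacency_bounds G i (ltW min0) minmax.
rewrite (principal_eigenvectorE i hx) => /andP[lo hi].
have /andP[mx xM] := minmax i.
have {}mx : min_entry x ^+ k.-1 <= x i 0 ^+ k.-1.
  by rewrite lerXn2r// nnegrE ltW.
have {}xM : x i 0 ^+ k.-1 <= max_entry x ^+ k.-1.
  by rewrite lerXn2r// nnegrE ltW.
have rho0 : 0 <= spectral_radius R G.
  rewrite -(pmulr_lge0 _ (exprn_gt0 k.-1 (x0 i))); apply: le_trans lo.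
  by rewrite mulr_ge0 ?ler0n ?exprn_ge0 ?(ltW min0).
have m0 := exprn_gt0 k.-1 min0; have M0 := exprn_gt0 k.-1 max0.
rewrite /principal_ratio expr_div_n; apply/andP; split.
  rewrite invf_div mulrA ler_pdivrMr//.
  by apply: le_trans lo _; rewrite ler_wpM2l.
rewrite mulrAC ler_pdivlMr// [leRHS]mulrC.
by apply: le_trans hi; rewrite ler_wpM2l.
Qed.

Lemma max_degree_attained k n (G : hypergraph k n.+1) :
  exists i, max_degree G = degree G i.
Proof.
rewrite /max_degree; elim/big_ind: _ => [|_ _ [i ->] [j ->]|i _].
- by exists ord0.
- by rewrite /maxn; case: ifP; [exists j | exists i].
- by exists i.
Qed.

Lemma min_degree_attained k n (G : hypergraph k n.+1) :
  exists i, min_degree G = degree G i.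
Proof.
rewrite /min_degree; elim/big_ind: _ => [|_ _ [i ->] [j ->]|i _].
- by exists ord0.
- by rewrite /minn; case: ifP; [exists i | exists j].
- by exists i.
Qed.

Theorem theorem3p3 (R : realType) (k n : nat) (hk : (2 <= k)%N)
    (G : hypergraph k n.+1) (hG : connected_hypergraph G)
    (x : 'cV[R]_n.+1) (hx : principal_eigenvector G x) :
  (max_degree G)%:R / principal_ratio x ^+ k.-1 <= spectral_radius R G /\
  spectral_radius R G <= principal_ratio x ^+ k.-1 * (min_degree G)%:R.
Proof.
have [i ->] := max_degree_attained G; have [j ->] := min_degree_attained G.
split; first by have /andP[] := degree_ratio_bounds i hx.
by have /andP[] := degree_ratio_bounds j hx.
Qed.
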